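(* If $Z$ is a presentation matrix for an $\mathsf{FI}$-module $M$, and if $W$ is the $\mathsf{FJ}$-module corresponding to the tail of $M$, then for every $\ell\in\mathbb N$ \[ W_\ell\;\cong\;\operatorname{coker}\,\Xi(\ell)_Z, \] where $\Xi(\ell)_Z$ denotes the integer block matrix obtained by evaluating the module $\Xi(\ell)$ at the entries of the $\mathsf{FI}$-matrix $Z$.
   Context: $\mathsf{FI}$ is the category of finite sets and injections; $[n]=\{1,\dots,n\}$. $\mathsf{FI}$-modules are functors $\mathsf{FI}\to\mathsf{Ab}$, $\mathsf{FI}^{\mathrm{op}}$-modules are functors $\mathsf{FI}^{\mathrm{op}}\to\mathsf{Ab}$. A finitely presented $\mathsf{FI}$-module $M$ is the cokernel of a map $\bigoplus_{j=1}^r\mathbb Z\mathsf{FI}([b_j],-)\to\bigoplus_{i=1}^g\mathbb Z\mathsf{FI}([a_i],-)$ of free modules. By Yoneda's lemma such a map is given by a presentation matrix ($\mathsf{FI}$-matrix) $Z$ with rows indexed by $a_1,\dots,a_g$ and columns by $b_1,\dots,b_r$, whose $(i,j)$ entry is a formal $\mathbb Z$-linear combination of injections $[a_i]\to[b_j]$; an injection $f\colon[a_i]\to[b_j]$ acts by $\mathbb Z\mathsf{FI}([b_j],-)\to\mathbb Z\mathsf{FI}([a_i],-)$, precomposition with $f$. For $\ell\in\mathbb N$, $\Xi(\ell)$ is the $\mathsf{FI}^{\mathrm{op}}$-module $\Xi(\ell)_S=H_0(X_S,A_S)$ (integer coefficients), where $X_S=\mathrm{Emb}(S,[\ell]\sqcup\mathbb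 R)$ is the space of injective maps $S\to[\ell]\sqcup\mathbb R$ and $A_S$ is the subspace of those $\phi$ with $[\ell]\not\subseteq\operatorname{im}\phi$. Injections act by precomposition. $\Xi(\ell)_Z\colon\bigoplus_j\Xi(\ell)_{b_j}\to\bigoplus_i\Xi(\ell)_{a_i}$ is the block matrix obtained by replacing each injection $f\colon[a_i]\to[b_j]$ in the entries of $Z$ by $\Xi(\ell)_f\colon\Xi(\ell)_{b_j}\to\Xi(\ell)_{a_i}$ and extending linearly. $\mathsf{FJ}$ is the category with objects $\mathbb N$ and $\mathsf{FJ}(\ell,m)=\mathrm{Hom}_{\mathsf{FI}^{\mathrm{op}}}(\Xi(\ell),\Xi(m))$. The $\mathsf{FJ}$-module corresponding to the tail of $M$ is $W=M\otimes_{\mathsf{FI}}\Xi(-)$, where $W_\ell=M\otimes_{\mathsf{FI}}\Xi(\ell)$ is the quotient of $\bigoplus_n M_n\otimes\Xi(\ell)_n$ by the relations $M_f(x)\otimes\xi-x\otimes\Xi(\ell)_f(\xi)$ for all injections $f\colon[a]\to[b]$, $x\in M_a$, $\xi\in\Xi(\ell)_b$. *)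

(* Defs.v *)
From HB Require Import structures.
From mathcomp Require Import all_boot all_order all_algebra generic_quotient.
From mathcomp Require Import freeg.
From mathcomp Require Import mathcomp_extra boolp classical_sets functions.
From mathcomp Require Import cardinality reals topology normedtype.

Set Implicit Arguments.
Unset Strict Implicit.
Unset Printing Implicit Defensive.

Import Order.TTheory GRing.Theory Num.Theory.
Import numFieldNormedType.Exports.

Local Open Scope classical_set_scope.
Local Open Scope ring_scope.
Local Open Scope quotient_scope.

Definition zmod_iso (A B : zmodType) : Prop :=
  exists phi : {additive A -> B}, bijective phi.

Definition zmod_subgroup (A : zmodType) : set (set A) :=
  [set H | H 0 /\ forall x y, H x -> H y -> H (x - y)].

Definition subgroup_gen (A : zmodType) (E : set A) : {pred A} :=
  mem (smallest (@zmod_subgroup A) E).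

Section QuotientGroup.
Variables (A : zmodType) (E : set A).

Lemma subgroup_gen_closed : zmod_closed (subgroup_gen E).
Proof.
split; first by rewrite inE => H [[H0 _] _].
move=> x y; rewrite !inE => Ex Ey H HP.
by case: (HP) => -[_ HB] _; apply: HB; [exact: Ex HP|exact: Ey HP].
Qed.

HB.instance Definition _ :=
  GRing.isZmodClosed.Build A (subgroup_gen E) subgroup_gen_closed.

(* [A / <E>], where [<E>] is the subgroup generated by [E]. *)
Definition zquot : zmodType := Quotient.quot (subgroup_gen E).

Definition zquot_pi (x : A) : zquot := \pi_zquot x.

Lemma zquot_pi_is_additive : zmod_morphism zquot_pi.
Proof. by move=> x y; rewrite /zquot_pi -raddfB. Qed.
HB.instance Definition _ :=
  GRing.isZmodMorphism.Build A zquot zquot_pi zquot_pi_is_additive.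

Lemma zquot_piP (x y : A) :
  zquot_pi x = zquot_pi y <-> smallest (@zmod_subgroup A) E (x - y).
Proof.
split=> [/eqP|xy]; last apply/eqP.
  by rewrite -Quotient.idealrBE inE.
by rewrite -Quotient.idealrBE inE.
Qed.

Lemma zquot_pi_surj (q : zquot) : exists x, q = zquot_pi x.
Proof. by exists (repr q); rewrite /zquot_pi reprK. Qed.

Lemma zquot_pi_eq0 (x : A) : E x -> zquot_pi x = 0.
Proof.
move=> Ex; rewrite -(raddf0 zquot_pi); apply/zquot_piP; rewrite subr0.
exact: sub_gen_smallest.
Qed.

End QuotientGroup.

Section QuotientLift.
Variables (A B : zmodType) (E : set A) (f : {additive A -> B}).
Hypothesis fE : forall x, E x -> f x = 0.

Lemma additive_gen0 x : smallest (@zmod_subgroup A) E x -> f x = 0.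
Proof.
apply: (@smallest_sub _ _ _ [set x | f x = 0]) => //.
by split=> [|y z /= fy fz]; rewrite /= ?raddf0 // raddfB fy fz subr0.
Qed.

Definition zquot_lift (_ : forall x, E x -> f x = 0) (q : zquot E) : B :=
  f (repr q).

Lemma zquot_liftE (x : A) : zquot_lift fE (zquot_pi E x) = f x.
Proof.
apply/eqP; rewrite -subr_eq0 -raddfB; apply/eqP/additive_gen0/zquot_piP.
by rewrite /zquot_pi reprK.
Qed.

Lemma zquot_lift_is_additive : zmod_morphism (zquot_lift fE).
Proof.
move=> p q; have [x ->] := zquot_pi_surj p; have [y ->] := zquot_pi_surj q.
by rewrite -raddfB !zquot_liftE raddfB.
Qed.
HB.instance Definition _ := GRing.isZmodMorphism.Build (zquot E) B
  (zquot_lift fE) zquot_lift_is_additive.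

End QuotientLift.

Section QuotientMap.
Variables (A B : zmodType) (E : set A) (F : set B) (f : {additive A -> B}).
Hypothesis fEF : forall x, E x -> smallest (@zmod_subgroup B) F (f x).

Lemma zquot_map_subproof x : E x -> (zquot_pi F \o f) x = 0.
Proof.
move=> Ex; rewrite -(raddf0 (zquot_pi F)); apply/zquot_piP; rewrite subr0.
exact: fEF.
Qed.

Definition zquot_map : {additive zquot E -> zquot F} :=
  zquot_lift zquot_map_subproof.

Lemma zquot_mapE x : zquot_map (zquot_pi E x) = zquot_pi F (f x).
Proof. exact: zquot_liftE. Qed.

End QuotientMap.

Definition coker (A B : zmodType) (f : {additive A -> B}) : zmodType :=
  zquot (range f).

Section FreeGroup.
Variable K : choiceType.

Definition zlift (M : zmodType) (f : K -> M) (x : {freeg K}) : M :=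
  fglift (f : K -> zmodule M) x.

Section Lift.
Variables (M : zmodType) (f : K -> M).

Lemma zlift_is_additive : zmod_morphism (zlift f).
Proof. by move=> x y; rewrite /zlift lift_is_additive. Qed.
HB.instance Definition _ :=
  GRing.isZmodMorphism.Build {freeg K} M (zlift f) zlift_is_additive.

Lemma zlift1 k : zlift f << k >> = f k.
Proof. by rewrite /zlift liftU scale1r. Qed.

End Lift.

Lemma freeg_additive_ext (M : zmodType) (f g : {additive {freeg K} -> M}) :
  (forall k, f << k >> = g << k >>) -> f =1 g.
Proof.
move=> fg x; rewrite -[x]freeg_sumE !raddf_sum; apply: eq_bigr => k _.
have -> : << coeff k x *g k >> = << k >> *~ coeff k x :> {freeg K}.
  by rewrite freegU_mulz intz.
by rewrite !raddfMz fg.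
Qed.

Lemma zliftB (M : zmodType) (f g : K -> M) x :
  zlift (fun k => f k - g k) x = zlift f x - zlift g x.
Proof.
apply: (freeg_additive_ext (g := zlift f \- zlift g)) => k.
by rewrite /= !zlift1.
Qed.

Lemma raddf_zlift (M N : zmodType) (h : {additive M -> N}) (f : K -> M) x :
  h (zlift f x) = zlift (fun k => h (f k)) x.
Proof.
apply: (freeg_additive_ext (f := h \o zlift f)) => k.
by rewrite /= !zlift1.
Qed.

End FreeGroup.

Definition freeg_map (K L : choiceType) (h : K -> L) :
    {additive {freeg K} -> {freeg L}} :=
  zlift (fun k => << h k >>).

Lemma freeg_map1 (K L : choiceType) (h : K -> L) k :
  freeg_map h << k >> = << h k >>.
Proof. exact: zlift1. Qed.

Section DirectSum.
Variables (I : choiceType) (T : I -> zmodType).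

(* The product of the [T i], which for finite [I] is also their direct sum; in
   general the direct sum is [dsum] below. *)
Definition zprod : Type := forall i, T i.
HB.instance Definition _ := Choice.copy zprod (forall i, T i).

Let add (x y : zprod) : zprod := fun i => x i + y i.
Let opp (x : zprod) : zprod := fun i => - x i.

Fact zprod_addA : associative add.
Proof.
by move=> x y z; apply: functional_extensionality_dep => i; exact: addrA.
Qed.
Fact zprod_addC : commutative add.
Proof.
by move=> x y; apply: functional_extensionality_dep => i; exact: addrC.
Qed.
Fact zprod_add0 : left_id ((fun=> 0) : zprod) add.
Proof.
by move=> x; apply: functional_extensionality_dep => i; exact: add0r.
Qed.
Fact zprod_addN : left_inverse ((fun=> 0) : zprod) opp add.
Proof.
by move=> x; apply: functional_extensionality_dep => i; exact: addNr.
Qed.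

HB.instance Definition _ :=
  GRing.isZmodule.Build zprod zprod_addA zprod_addC zprod_add0 zprod_addN.

End DirectSum.

Section FiniteSupport.
Variables (I : choiceType) (T : I -> zmodType).

Definition fin_supp : {pred zprod T} :=
  [pred x | `[< finite_set [set i | x i != 0] >]].

Lemma fin_supp_closed : zmod_closed fin_supp.
Proof.
split=> [|x y]; rewrite !inE.
  have -> : [set i | (0 : zprod T) i != 0] = set0; last exact: finite_set0.
  by apply/seteqP; split=> i //=; rewrite eqxx.
move=> Fx Fy.
have := conj Fx Fy; rewrite -finite_setU; apply: sub_finite_set => i /=.
case: (eqVneq (x i) 0) => [x0|]; last by left.
case: (eqVneq (y i) 0) => [y0|]; last by right.
suff -> : (x - y) i = 0 by rewrite eqxx.
by rewrite -[LHS]/(x i - y i) x0 y0 subrr.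
Qed.

HB.instance Definition _ :=
  GRing.isZmodClosed.Build (zprod T) fin_supp fin_supp_closed.

Record dsum := DSum { dsum_val : zprod T; dsumP : dsum_val \in fin_supp }.
HB.instance Definition _ := [isSub for dsum_val].
HB.instance Definition _ := [Choice of dsum by <:].
HB.instance Definition _ := [SubChoice_isSubZmodule of dsum by <:].

Definition dsum_fun (x : dsum) : forall i, T i := dsum_val x.
Coercion dsum_fun : dsum >-> Funclass.

Lemma dsum_ext (x y : dsum) : (forall i, x i = y i) -> x = y.
Proof. by move=> xy; apply/val_inj/functional_extensionality_dep. Qed.

Definition dinj_fun (i : I) (x : T i) : zprod T :=
  dfwith (fun j => 0 : T j) i x.

Lemma dinj_subproof i (x : T i) : dinj_fun x \in fin_supp.
Proof.
rewrite inE; apply: (@sub_finite_set _ _ [set i]); last exact: finite_set1.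
move=> j /=; apply: contraNP => /eqP ji.
by rewrite /dinj_fun dfwithout // eq_sym.
Qed.

Definition dinj i (x : T i) : dsum := DSum (dinj_subproof x).

Lemma dinjE i (x : T i) : dinj x i = x.
Proof. exact: dfwithin. Qed.

Lemma dinj_neq i j (x : T i) : i != j -> dinj x j = 0.
Proof. exact: dfwithout. Qed.

Lemma dinj_is_additive i : zmod_morphism (@dinj i).
Proof.
move=> x y; apply: dsum_ext => j; have [<-|ij] := eqVneq i j.
  by rewrite -[RHS]/(dinj x i - dinj y i) !dinjE.
by rewrite -[RHS]/(dinj x j - dinj y j) !dinj_neq ?subr0.
Qed.
HB.instance Definition _ i :=
  GRing.isZmodMorphism.Build (T i) dsum (@dinj i) (@dinj_is_additive i).

End FiniteSupport.

Section DirectSumMap.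
Variables (I : choiceType) (T U : I -> zmodType).
Variable f : forall i, {additive T i -> U i}.

Definition zprod_map (x : zprod T) : zprod U := fun i => f i (x i).

Lemma zprod_map_is_additive : zmod_morphism zprod_map.
Proof.
move=> x y; apply: functional_extensionality_dep => i; exact: raddfB.
Qed.
HB.instance Definition _ := GRing.isZmodMorphism.Build (zprod T) (zprod U)
  zprod_map zprod_map_is_additive.

Lemma dsum_map_subproof (x : dsum T) : zprod_map (dsum_val x) \in @fin_supp I U.
Proof.
have := dsumP x; rewrite !inE; apply: sub_finite_set => i /=.
by apply: contra_neq => x0; rewrite /zprod_map x0 raddf0.
Qed.

Definition dsum_map (x : dsum T) : dsum U := DSum (dsum_map_subproof x).

Lemma dsum_map_is_additive : zmod_morphism dsum_map.
Proof. by move=> x y; apply: dsum_ext => i; exact: raddfB. Qed.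
HB.instance Definition _ := GRing.isZmodMorphism.Build (dsum T) (dsum U)
  dsum_map dsum_map_is_additive.

Lemma dsum_map_dinj i (x : T i) : dsum_map (dinj x) = dinj (f i x).
Proof.
apply: dsum_ext => j; rewrite -[LHS]/(f j (dinj x j)).
have [<-|ij] := eqVneq i j; first by rewrite !dinjE.
by rewrite !dinj_neq // raddf0.
Qed.

End DirectSumMap.

Definition bilinear_rel (A B : zmodType) : set {freeg A * B} :=
  [set z | exists x x' y, z = << (x + x', y) >> - << (x, y) >> - << (x', y) >>]
  `|`
  [set z | exists x y y', z = << (x, y + y') >> - << (x, y) >> - << (x, y') >>].

Definition tensor (A B : zmodType) : zmodType := zquot (@bilinear_rel A B).

Definition tens (A B : zmodType) (x : A) (y : B) : tensor A B :=
  zquot_pi _ << (x, y) >>.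

Lemma tensDl (A B : zmodType) (x x' : A) (y : B) :
  tens (x + x') y = tens x y + tens x' y.
Proof.
have : @bilinear_rel A B (<< (x + x', y) >> - << (x, y) >> - << (x', y) >>).
  by left; exists x, x', y.
move=> /zquot_pi_eq0/eqP; rewrite !raddfB subr_eq0 subr_eq => /eqP.
by move=> e; rewrite [RHS]addrC; exact: e.
Qed.

Lemma tensDr (A B : zmodType) (x : A) (y y' : B) :
  tens x (y + y') = tens x y + tens x y'.
Proof.
have : @bilinear_rel A B (<< (x, y + y') >> - << (x, y) >> - << (x, y') >>).
  by right; exists x, y, y'.
move=> /zquot_pi_eq0/eqP; rewrite !raddfB subr_eq0 subr_eq => /eqP.
by move=> e; rewrite [RHS]addrC; exact: e.
Qed.

Section TensorMap.
Variables (A B B' : zmodType) (h : {additive B -> B'}).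

Let g : A * B -> A * B' := fun p => (p.1, h p.2).

Lemma tensor_map_subproof z : @bilinear_rel A B z ->
  smallest (@zmod_subgroup _) (@bilinear_rel A B') (freeg_map g z).
Proof.
move=> zR; apply: sub_gen_smallest; case: zR.
  move=> [x [x' [y ->]]]; left; exists x, x', (h y).
  by rewrite !raddfB !freeg_map1.
move=> [x [y [y' ->]]]; right; exists x, (h y), (h y').
by rewrite !raddfB !freeg_map1 /g /= raddfD.
Qed.

Definition tensor_map : {additive tensor A B -> tensor A B'} :=
  zquot_map tensor_map_subproof.

Lemma tensor_mapE x y : tensor_map (tens x y) = tens x (h y).
Proof. by rewrite /tens [LHS]zquot_mapE /= zlift1. Qed.

End TensorMap.

Lemma tensor_additive_ext (A B C : zmodType)
    (f g : {additive tensor A B -> C}) :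
  (forall x y, f (tens x y) = g (tens x y)) -> f =1 g.
Proof.
move=> fg t; have [x ->] := zquot_pi_surj t.
apply: (freeg_additive_ext (f := f \o zquot_pi _) (g := g \o zquot_pi _)).
by case=> a b; exact: fg.
Qed.

Section FI.

(* Morphisms of [FI], whose objects are the [finType]s; [[n]] is ['I_n]. *)
Record FIhom (S T : finType) := FIHom
  { FIhom_fun :> {ffun S -> T}; FIhom_inj : injectiveb FIhom_fun }.

HB.instance Definition _ S T := [isSub for @FIhom_fun S T].
HB.instance Definition _ S T := [Finite of FIhom S T by <:].

Lemma FIhom_injective S T (f : FIhom S T) : injective f.
Proof. exact/injectiveP/FIhom_inj. Qed.

Lemma FIid_subproof (S : finType) : injectiveb [ffun x : S => x].
Proof. by apply/injectiveP => x y; rewrite !ffunE. Qed.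
Definition FIid S : FIhom S S := FIHom (FIid_subproof S).

Lemma FIcomp_subproof S T U (g : FIhom T U) (f : FIhom S T) :
  injectiveb [ffun x : S => g (f x)].
Proof.
by apply/injectiveP => x y; rewrite !ffunE => /FIhom_injective/FIhom_injective.
Qed.
Definition FIcomp S T U (g : FIhom T U) (f : FIhom S T) : FIhom S U :=
  FIHom (FIcomp_subproof g f).

Lemma FIcompE S T U (g : FIhom T U) (f : FIhom S T) x : FIcomp g f x = g (f x).
Proof. by rewrite /= ffunE. Qed.

Lemma FIcomp1l S T (f : FIhom S T) : FIcomp (FIid T) f = f.
Proof. by apply/val_inj/ffunP => x; rewrite /= !ffunE. Qed.
Lemma FIcomp1r S T (f : FIhom S T) : FIcomp f (FIid S) = f.
Proof. by apply/val_inj/ffunP => x; rewrite /= !ffunE. Qed.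
Lemma FIcompA S T U V (h : FIhom U V) (g : FIhom T U) (f : FIhom S T) :
  FIcomp h (FIcomp g f) = FIcomp (FIcomp h g) f.
Proof. by apply/val_inj/ffunP => x; rewrite /= !ffunE. Qed.

End FI.

Record FImod := FIMod {
  FIobj :> finType -> zmodType;
  FImap : forall S T, FIhom S T -> {additive FIobj S -> FIobj T};
  FImap_id : forall S x, FImap (FIid S) x = x;
  FImap_comp : forall S T U (g : FIhom T U) (f : FIhom S T) x,
    FImap (FIcomp g f) x = FImap g (FImap f x) }.

Record FIopmod := FIopMod {
  FIopobj :> finType -> zmodType;
  FIopmap : forall S T, FIhom S T -> {additive FIopobj T -> FIopobj S};
  FIopmap_id : forall S x, FIopmap (FIid S) x = x;
  FIopmap_comp : forall S T U (g : FIhom T U) (f : FIhom S T) x,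
    FIopmap (FIcomp g f) x = FIopmap f (FIopmap g x) }.

Record FImodhom (M N : FImod) := FIModHom {
  FImodhom_fun :> forall S, {additive M S -> N S};
  FImodhomP : forall S T (f : FIhom S T) x,
    FImodhom_fun T (FImap M f x) = FImap N f (FImodhom_fun S x) }.

Definition FImod_iso (M N : FImod) : Prop :=
  exists phi : FImodhom M N, forall S, bijective (phi S).

Section FImodSum.
Variables (n : nat) (N : 'I_n -> FImod).

Definition FImod_sum_map S T (f : FIhom S T) :
    {additive zprod (fun i => N i S) -> zprod (fun i => N i T)} :=
  zprod_map (fun i => FImap (N i) f).

Fact FImod_sum_map_id S x : FImod_sum_map (FIid S) x = x.
Proof. by apply: functional_extensionality_dep => i; exact: FImap_id. Qed.

Fact FImod_sum_map_comp S T U (g : FIhom T U) (f : FIhom S T) x :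
  FImod_sum_map (FIcomp g f) x = FImod_sum_map g (FImod_sum_map f x).
Proof. by apply: functional_extensionality_dep => i; exact: FImap_comp. Qed.

Definition FImod_sum : FImod :=
  @FIMod (fun S => zprod (fun i => N i S)) FImod_sum_map
    FImod_sum_map_id FImod_sum_map_comp.

End FImodSum.

Section FImodCoker.
Variables (M N : FImod) (phi : FImodhom M N).

Lemma FImod_coker_map_subproof S T (f : FIhom S T) x :
  range (phi S) x -> smallest (@zmod_subgroup _) (range (phi T)) (FImap N f x).
Proof.
case=> y _ <-; apply: sub_gen_smallest.
by exists (FImap M f y); rewrite ?FImodhomP.
Qed.

Definition FImod_coker_map S T (f : FIhom S T) :
    {additive coker (phi S) -> coker (phi T)} :=
  zquot_map (@FImod_coker_map_subproof S T f).

Lemma FImod_coker_mapE S T (f : FIhom S T) x :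
  FImod_coker_map f (zquot_pi _ x) = zquot_pi _ (FImap N f x).
Proof. exact: zquot_mapE. Qed.

Fact FImod_coker_map_id S x : FImod_coker_map (FIid S) x = x.
Proof.
by have [y ->] := zquot_pi_surj x; rewrite FImod_coker_mapE FImap_id.
Qed.

Fact FImod_coker_map_comp S T U (g : FIhom T U) (f : FIhom S T) x :
  FImod_coker_map (FIcomp g f) x = FImod_coker_map g (FImod_coker_map f x).
Proof.
by have [y ->] := zquot_pi_surj x; rewrite !FImod_coker_mapE FImap_comp.
Qed.

Definition FImod_coker : FImod :=
  @FIMod (fun S => coker (phi S)) FImod_coker_map
    FImod_coker_map_id FImod_coker_map_comp.

End FImodCoker.

Record FIophom (X Y : FIopmod) := FIopHom {
  FIophom_fun :> forall S, {additive X S -> Y S};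
  FIophomP : forall S T (f : FIhom S T) x,
    FIophom_fun S (FIopmap X f x) = FIopmap Y f (FIophom_fun T x) }.

Definition FIophom_id (X : FIopmod) : FIophom X X :=
  @FIopHom X X (fun S => idfun) (fun S T f x => erefl).

Fact FIophom_comp_subproof (X Y Z : FIopmod) (psi : FIophom Y Z)
    (phi : FIophom X Y) S T (f : FIhom S T) x :
  (psi S \o phi S) (FIopmap X f x) = FIopmap Z f ((psi T \o phi T) x).
Proof. by rewrite /= !FIophomP. Qed.
Definition FIophom_comp (X Y Z : FIopmod) (psi : FIophom Y Z)
    (phi : FIophom X Y) : FIophom X Z :=
  FIopHom (FIophom_comp_subproof psi phi).

Section Representable.

Definition ZFI_post (A S T : finType) (f : FIhom S T) :
    {additive {freeg FIhom A S} -> {freeg FIhom A T}} :=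
  freeg_map (fun h => FIcomp f h).

Definition ZFI_pre (S A B : finType) (f : FIhom A B) :
    {additive {freeg FIhom B S} -> {freeg FIhom A S}} :=
  freeg_map (fun h => FIcomp h f).

Lemma ZFI_post1 A S T (f : FIhom S T) (h : FIhom A S) :
  ZFI_post A f << h >> = << FIcomp f h >>.
Proof. exact: freeg_map1. Qed.

Lemma ZFI_pre1 S A B (f : FIhom A B) (h : FIhom B S) :
  ZFI_pre S f << h >> = << FIcomp h f >>.
Proof. exact: freeg_map1. Qed.

Fact ZFI_post_id A S x : ZFI_post A (FIid S) x = x.
Proof.
apply: (freeg_additive_ext (g := idfun)) => h.
by rewrite ZFI_post1 FIcomp1l.
Qed.

Fact ZFI_post_comp A S T U (g : FIhom T U) (f : FIhom S T) x :
  ZFI_post A (FIcomp g f) x = ZFI_post A g (ZFI_post A f x).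
Proof.
apply: (freeg_additive_ext (g := ZFI_post A g \o ZFI_post A f)) => h.
by rewrite /= !ZFI_post1 FIcompA.
Qed.

Fact ZFI_pre_id S A x : ZFI_pre S (FIid A) x = x.
Proof.
apply: (freeg_additive_ext (g := idfun)) => h.
by rewrite ZFI_pre1 FIcomp1r.
Qed.

Fact ZFI_pre_comp S A B C (g : FIhom B C) (f : FIhom A B) x :
  ZFI_pre S (FIcomp g f) x = ZFI_pre S f (ZFI_pre S g x).
Proof.
apply: (freeg_additive_ext (g := ZFI_pre S f \o ZFI_pre S g)) => h.
by rewrite /= !ZFI_pre1 FIcompA.
Qed.

(* [Z FI(A, -)] *)
Definition ZFI (A : finType) : FImod :=
  @FIMod (fun S => {freeg FIhom A S}) (@ZFI_post A)
    (@ZFI_post_id A) (@ZFI_post_comp A).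

(* [Z FI(-, S)] *)
Definition ZFIop (S : finType) : FIopmod :=
  @FIopMod (fun A => {freeg FIhom A S}) (@ZFI_pre S)
    (@ZFI_pre_id S) (@ZFI_pre_comp S).

Fact ZFIop_hom_subproof S T (f : FIhom S T) A B (g : FIhom A B) x :
  ZFI_post A f (ZFI_pre S g x) = ZFI_pre T g (ZFI_post B f x).
Proof.
apply: (freeg_additive_ext (f := ZFI_post A f \o ZFI_pre S g)
  (g := ZFI_pre T g \o ZFI_post B f)) => h.
by rewrite /= !(ZFI_pre1, ZFI_post1) FIcompA.
Qed.

Definition ZFIop_hom S T (f : FIhom S T) : FIophom (ZFIop S) (ZFIop T) :=
  @FIopHom (ZFIop S) (ZFIop T) (fun A => ZFI_post A f)
    (@ZFIop_hom_subproof S T f).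

End Representable.

Definition FImatrix (g r : nat) (a : 'I_g -> nat) (b : 'I_r -> nat) :=
  forall (i : 'I_g) (j : 'I_r), {freeg FIhom 'I_(a i) 'I_(b j)}.

Section Evaluation.
Variables (g r : nat) (a : 'I_g -> nat) (b : 'I_r -> nat) (Z : FImatrix a b).

Definition FIop_eval_fun (X : FIopmod) (x : zprod (fun j => X 'I_(b j))) :
    zprod (fun i => X 'I_(a i)) :=
  fun i => \sum_j zlift (fun f => FIopmap X f (x j)) (Z i j).

Lemma FIop_eval_is_additive X : zmod_morphism (@FIop_eval_fun X).
Proof.
move=> x y; apply: functional_extensionality_dep => i.
rewrite -[RHS]/(FIop_eval_fun x i - FIop_eval_fun y i) /FIop_eval_fun -sumrB.
apply: eq_bigr => j _; rewrite -zliftB; congr zlift.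
by apply: functional_extensionality_dep => f; rewrite -raddfB.
Qed.
HB.instance Definition _ X :=
  GRing.isZmodMorphism.Build _ _ (@FIop_eval_fun X) (@FIop_eval_is_additive X).

(* [X_Z : (+)_j X_[b j] -> (+)_i X_[a i]]. *)
Definition FIop_eval (X : FIopmod) :
    {additive zprod (fun j => X 'I_(b j)) -> zprod (fun i => X 'I_(a i))} :=
  @FIop_eval_fun X.

Lemma FIop_eval_nat (X Y : FIopmod) (phi : FIophom X Y) x :
  zprod_map (fun i => phi 'I_(a i)) (FIop_eval X x) =
  FIop_eval Y (zprod_map (fun j => phi 'I_(b j)) x).
Proof.
apply: functional_extensionality_dep => i.
rewrite /zprod_map /= /FIop_eval_fun raddf_sum; apply: eq_bigr => j _.
rewrite raddf_zlift; congr zlift.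
by apply: functional_extensionality_dep => f; rewrite FIophomP.
Qed.

(* At [S], the map [(+)_j Z FI([b j], S) -> (+)_i Z FI([a i], S)] given by [Z]
   precomposes with the entries of [Z], so it is the evaluation at [Z] of the
   [FI^op]-module [Z FI(-, S)]. *)
Definition FIpres_fun (S : finType) :
    {additive FImod_sum (fun j => ZFI 'I_(b j)) S ->
              FImod_sum (fun i => ZFI 'I_(a i)) S} :=
  FIop_eval (ZFIop S).

Fact FIpres_subproof S T (f : FIhom S T) x :
  FIpres_fun T (FImap (FImod_sum (fun j => ZFI 'I_(b j))) f x) =
  FImap (FImod_sum (fun i => ZFI 'I_(a i))) f (FIpres_fun S x).
Proof. by rewrite [RHS](FIop_eval_nat (ZFIop_hom f)). Qed.

Definition FIpres : FImodhom (FImod_sum (fun j => ZFI 'I_(b j)))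
                             (FImod_sum (fun i => ZFI 'I_(a i))) :=
  FIModHom FIpres_subproof.

Definition presentation_matrix (M : FImod) : Prop :=
  FImod_iso M (FImod_coker FIpres).

End Evaluation.

Definition disjoint_union (X Y : Type) : Type := X + Y.

Section DisjointUnion.
Variables X Y : topologicalType.

HB.instance Definition _ := Choice.copy (disjoint_union X Y) (X + Y)%type.

Let op : set_system (disjoint_union X Y) :=
  [set U | open (inl @^-1` U : set X) /\ open (inr @^-1` U : set Y)].

Fact disjoint_union_opT : op setT.
Proof. by split; rewrite preimage_setT; exact: openT. Qed.
Fact disjoint_union_opI : setI_closed op.
Proof.
by move=> U V [? ?] [? ?]; split; rewrite preimage_setI; exact: openI.
Qed.
Fact disjoint_union_op_bigU (I : Type) (U : I -> set (disjoint_union X Y)) :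
  (forall i, op (U i)) -> op (\bigcup_i U i).
Proof.
by move=> opU; split; rewrite preimage_bigcup; apply: bigcup_open => i _;
  have [] := opU i.
Qed.

HB.instance Definition _ := isOpenTopological.Build (disjoint_union X Y)
  disjoint_union_opT disjoint_union_opI disjoint_union_op_bigU.

End DisjointUnion.

Section RelativeH0.
Variable R : realType.

Definition H0_rel (X : topologicalType) (A : set X) : set {freeg X} :=
  [set << x >> | x in A] `|`
  [set << gam 1 >> - << gam 0 >> | gam in
    [set gam : R -> X | {within `[0, 1], continuous gam}]].

(* The singular 0-simplices of [X] are its points and the singular 1-simplices
   are the paths [0, 1] -> X, so this is [C_0(X) / (C_0(A) + d C_1(X))]. Paths
   are represented by functions on [R] restricted to [0, 1]. *)
Definition H0 (X : topologicalType) (A : set X) : zmodType := zquot (H0_rel A).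

Section H0Map.
Variables (X Y : topologicalType) (A : set X) (B : set Y) (h : X -> Y).
Hypotheses (hc : continuous h) (hAB : forall x, A x -> B (h x)).

Lemma H0_map_subproof z : H0_rel A z ->
  smallest (@zmod_subgroup _) (H0_rel B) (freeg_map h z).
Proof.
move=> zR; apply: sub_gen_smallest; case: zR => [[x Ax <-]|[gam gamc <-]].
  by left; exists (h x); [exact: hAB|rewrite freeg_map1].
right; exists (h \o gam); last by rewrite raddfB !freeg_map1.
by apply: within_continuous_comp => // x _; exact: hc.
Qed.

Definition H0_map : {additive H0 A -> H0 B} := zquot_map H0_map_subproof.

End H0Map.
End RelativeH0.

Section Emb.
Variable Y : topologicalType.

Definition inj_set (S : finType) : set {ptws S -> Y} :=
  [set phi | injective phi].

Definition Emb (S : finType) : topologicalType := @inj_set S.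

Definition Emb_fun S (phi : Emb S) : S -> Y := \val phi.

Lemma Emb_inj S (phi : Emb S) : injective (Emb_fun phi).
Proof. by case: phi => phi phiP; exact: (set_mem phiP). Qed.

Lemma Emb_ext S (phi psi : Emb S) :
  (forall s, Emb_fun phi s = Emb_fun psi s) -> phi = psi.
Proof. move=> pq; apply: val_inj; exact: funext. Qed.

Section Restriction.
Variables (S T : finType) (f : FIhom S T).

Fact Emb_map_subproof (phi : Emb T) :
  ((Emb_fun phi \o f) : {ptws S -> Y}) \in @inj_set S.
Proof.
apply: mem_set; exact: (inj_comp (@Emb_inj _ phi) (@FIhom_injective _ _ f)).
Qed.

Definition Emb_map (phi : Emb T) : Emb S :=
  @exist _ (fun psi => psi \in @inj_set S) _ (Emb_map_subproof phi).

Lemma Emb_map_continuous : continuous Emb_map.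
Proof.
apply: continuous_comp_initial => phi; apply/cvg_sup.
  exact/fmap_filter/nbhs_filter.
move=> s; move: phi; apply/(@continuousP _ (initial_topology (@^~ s))) => A.
move=> [B oB <-]; exists (@proj T (fun=> Y) (f s) @^-1` B) => //.
by apply: open_comp => // phi _; exact: (@proj_continuous T (fun=> Y)).
Qed.

End Restriction.
End Emb.

Section Xi.
Variables (R : realType) (l : nat).

Definition Xi_target : topologicalType :=
  disjoint_union (discrete_topology 'I_l) R.

Definition Xi_space (S : finType) : topologicalType := Emb Xi_target S.

Definition Xi_sub (S : finType) : set (Xi_space S) :=
  [set phi | ~ (range (inl : 'I_l -> Xi_target) `<=` range (Emb_fun phi))].

Lemma Xi_sub_map S T (f : FIhom S T) (phi : Xi_space T) :
  Xi_sub phi -> Xi_sub (Emb_map f phi).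
Proof.
by move=> nphi sub; apply: nphi => k /sub [s _ <-]; exists (f s).
Qed.

Definition Xi_map S T (f : FIhom S T) :
    {additive H0 R (@Xi_sub T) -> H0 R (@Xi_sub S)} :=
  H0_map R (@Emb_map_continuous _ S T f) (@Xi_sub_map S T f).

Lemma Xi_mapE S T (f : FIhom S T) x :
  Xi_map f (zquot_pi _ x) = zquot_pi _ (freeg_map (Emb_map f) x).
Proof. exact: zquot_mapE. Qed.

Fact Xi_map_id S x : Xi_map (FIid S) x = x.
Proof.
have [y ->] := zquot_pi_surj x; rewrite Xi_mapE; congr zquot_pi.
apply: (freeg_additive_ext (g := idfun)) => phi; rewrite freeg_map1.
by congr (<< _ >>); apply: Emb_ext => s; rewrite /Emb_fun /= ffunE.
Qed.

Fact Xi_map_comp S T U (g : FIhom T U) (f : FIhom S T) x :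
  Xi_map (FIcomp g f) x = Xi_map f (Xi_map g x).
Proof.
have [y ->] := zquot_pi_surj x; rewrite !Xi_mapE; congr zquot_pi.
apply: (freeg_additive_ext
  (g := freeg_map (Emb_map f) \o freeg_map (Emb_map g))) => phi.
rewrite /= !freeg_map1.
by congr (<< _ >>); apply: Emb_ext => s; rewrite /Emb_fun /= ffunE.
Qed.

Definition Xi : FIopmod :=
  @FIopMod (fun S => H0 R (@Xi_sub S)) Xi_map Xi_map_id Xi_map_comp.

End Xi.

Section TensorFI.
Variable M : FImod.

Section Object.
Variable X : FIopmod.

Definition tensorFI_sum : zmodType :=
  dsum (fun n : nat => tensor (M 'I_n) (X 'I_n)).

Definition tensorFI_in (n : nat) (x : M 'I_n) (xi : X 'I_n) : tensorFI_sum :=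
  @dinj _ (fun n : nat => tensor (M 'I_n) (X 'I_n)) n (tens x xi).

Definition tensorFI_rel : set tensorFI_sum :=
  [set w | exists (a b : nat) (f : FIhom 'I_a 'I_b) (x : M 'I_a) (xi : X 'I_b),
    w = tensorFI_in (FImap M f x) xi - tensorFI_in x (FIopmap X f xi)].

Definition tensorFI : zmodType := zquot tensorFI_rel.

End Object.

Section Morphism.
Variables (X Y : FIopmod) (phi : FIophom X Y).

Definition tensorFI_sum_map : {additive tensorFI_sum X -> tensorFI_sum Y} :=
  dsum_map (fun n => tensor_map (M 'I_n) (phi 'I_n)).

Lemma tensorFI_sum_map_in n (x : M 'I_n) (xi : X 'I_n) :
  tensorFI_sum_map (tensorFI_in x xi) = tensorFI_in x (phi _ xi).
Proof. by rewrite [LHS]dsum_map_dinj tensor_mapE. Qed.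

Lemma tensorFI_map_subproof w : tensorFI_rel w ->
  smallest (@zmod_subgroup _) (@tensorFI_rel Y) (tensorFI_sum_map w).
Proof.
move=> [a [b [f [x [xi ->]]]]]; apply: sub_gen_smallest.
exists a, b, f, x, (phi _ xi).
by rewrite raddfB !tensorFI_sum_map_in FIophomP.
Qed.

Definition tensorFI_map : {additive tensorFI X -> tensorFI Y} :=
  zquot_map tensorFI_map_subproof.

Lemma tensorFI_mapE w :
  tensorFI_map (zquot_pi _ w) = zquot_pi _ (tensorFI_sum_map w).
Proof. exact: zquot_mapE. Qed.

End Morphism.

Fact tensorFI_map_id (X : FIopmod) w : tensorFI_map (FIophom_id X) w = w.
Proof.
have [v ->] := zquot_pi_surj w; rewrite tensorFI_mapE; congr zquot_pi.
apply: dsum_ext => n.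
apply: (tensor_additive_ext (g := idfun)) => x y; exact: tensor_mapE.
Qed.

Fact tensorFI_map_comp (X Y Z : FIopmod) (psi : FIophom Y Z)
    (phi : FIophom X Y) w :
  tensorFI_map (FIophom_comp psi phi) w =
  tensorFI_map psi (tensorFI_map phi w).
Proof.
have [v ->] := zquot_pi_surj w; rewrite !tensorFI_mapE; congr zquot_pi.
apply: dsum_ext => n.
apply: (tensor_additive_ext (g := tensor_map _ (psi _) \o
  tensor_map _ (phi _))) => x y.
rewrite [LHS]tensor_mapE; symmetry.
apply: etrans (congr1 _ (tensor_mapE _ _ _)) _; exact: tensor_mapE.
Qed.

Fact tensorFI_map_add (X Y : FIopmod) (phi psi chi : FIophom X Y) w :
  (forall S x, chi S x = phi S x + psi S x) ->
  tensorFI_map chi w = tensorFI_map phi w + tensorFI_map psi w.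
Proof.
move=> chiE; have [v ->] := zquot_pi_surj w.
rewrite !tensorFI_mapE -raddfD; congr zquot_pi; apply: dsum_ext => n.
apply: (tensor_additive_ext (g := tensor_map _ (phi _) \+
  tensor_map _ (psi _))) => x y.
rewrite [LHS]tensor_mapE chiE tensDr; symmetry.
by congr (_ + _); exact: tensor_mapE.
Qed.

End TensorFI.

Definition FJhom (R : realType) (l m : nat) := FIophom (Xi R l) (Xi R m).

(* Additive functors from [FJ] to abelian groups; the hom-sets of [FJ] are
   abelian groups under pointwise addition. *)
Record FJmod (R : realType) := FJMod {
  FJobj :> nat -> zmodType;
  FJmap : forall l m, FJhom R l m -> {additive FJobj l -> FJobj m};
  FJmap_id : forall l x, FJmap (FIophom_id (Xi R l)) x = x;
  FJmap_comp : forall l m n (psi : FJhom R m n) (phi : FJhom R l m) x,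
    FJmap (FIophom_comp psi phi) x = FJmap psi (FJmap phi x);
  FJmap_add : forall l m (phi psi chi : FJhom R l m) x,
    (forall S xi, chi S xi = phi S xi + psi S xi) ->
    FJmap chi x = FJmap phi x + FJmap psi x }.

(* [W = M (x)_FI Xi(-)], on which [FJ] acts through the second factor. *)
Definition FJtail (R : realType) (M : FImod) : FJmod R :=
  @FJMod R (fun l => tensorFI M (Xi R l)) (fun l m => @tensorFI_map M _ _)
    (fun l => @tensorFI_map_id M _) (fun l m n => @tensorFI_map_comp M _ _ _)
    (fun l m => @tensorFI_map_add M _ _).

(* Main.v *)
Require Import Defs.
From HB Require Import structures.
From mathcomp Require Import all_boot all_order all_algebra.
From mathcomp Require Import freeg.
From mathcomp Require Import boolp classical_sets cardinality.
From mathcomp Require Import fsbigop reals.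

(* For every FI^op-module X one has M (x)_FI X = coker X_Z. An element xi of X_S
   corresponds by Yoneda to a map Z FI(-, S) -> X; evaluated at the a_i, this
   map sends an element p of (+)_i Z FI([a_i], S) representing x in M_S to an
   element of (+)_i X_[a_i], and naturality with respect to Z makes its class in
   coker X_Z depend only on x. This gives x (x) xi |-> [yoneda xi p]. The
   inverse sends (y_i) to the sum of the m_i (x) y_i, where m_i in M_[a_i] are
   the generators of the presentation. *)

Set Implicit Arguments.
Unset Strict Implicit.
Unset Printing Implicit Defensive.

Import GRing.Theory.
Local Open Scope classical_set_scope.
Local Open Scope ring_scope.

(** * Universal property and additivity of tensor products *)

Section TensorLift.
Variables (A B C : zmodType) (h : A -> B -> C).
Hypothesis hDl : forall x x' y, h (x + x') y = h x y + h x' y.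
Hypothesis hDr : forall x y y', h x (y + y') = h x y + h x y'.

Fact tensor_lift_subproof z :
  @bilinear_rel A B z -> zlift (fun p => h p.1 p.2) z = 0.
Proof.
case=> [[x [x' [y ->]]]|[x [y [y' ->]]]]; rewrite !raddfB /= !zlift1 /=.
  by rewrite hDl addrAC addrK subrr.
by rewrite hDr addrAC addrK subrr.
Qed.

Definition tensor_lift : {additive tensor A B -> C} :=
  zquot_lift tensor_lift_subproof.

Lemma tensor_liftE x y : tensor_lift (tens x y) = h x y.
Proof. by rewrite [LHS]zquot_liftE /= zlift1. Qed.

End TensorLift.

Section TensRight.
Variables (A B : zmodType) (y : B).

Definition tens_right (x : A) : tensor A B := tens x y.

Fact tens_right_is_additive : zmod_morphism tens_right.
Proof.
move=> x x'; apply/eqP.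
by rewrite /tens_right eq_sym subr_eq -tensDl subrK.
Qed.
HB.instance Definition _ := GRing.isZmodMorphism.Build A (tensor A B)
  tens_right tens_right_is_additive.

End TensRight.

Section TensLeft.
Variables (A B : zmodType) (x : A).

Fact tens_left_is_additive : zmod_morphism (@tens A B x).
Proof. by move=> y y'; apply/eqP; rewrite eq_sym subr_eq -tensDr subrK. Qed.
HB.instance Definition _ := GRing.isZmodMorphism.Build B (tensor A B)
  (@tens A B x) tens_left_is_additive.

End TensLeft.

(* Stated for a variable family [T]: inference of the additive structure of
   [dinj] fails when [T] is a lambda-abstraction. *)
Definition dinj_additive (I : choiceType) (T : I -> zmodType) (i : I) :
  {additive T i -> dsum T} := @dinj I T i.

(** * Maps out of direct sums *)

Section DirectSumLift.
Variables (I : choiceType) (T : I -> zmodType) (B : zmodType).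

(** One list covers both supports, so that additivity can be checked on sums over the same
    indices. *)
Lemma dsum_supp (x y : dsum T) : exists s : seq I,
  [/\ uniq s, forall i, i \notin s -> x i = 0
    & forall i, i \notin s -> y i = 0].
Proof.
have Fx : finite_set [set i | x i != 0] by have := dsumP x; rewrite inE.
have Fy : finite_set [set i | y i != 0] by have := dsumP y; rewrite inE.
have [s sE] : exists s : seq I,
    [set i | x i != 0] `|` [set i | y i != 0] = [set` s].
  by apply/finite_seqP; rewrite finite_setU.
exists (undup s); split=> [|i|i]; first exact: undup_uniq.
  rewrite mem_undup; apply: contraNeq => xi.
  by have : [set` s] i by rewrite -sE; left.
rewrite mem_undup; apply: contraNeq => yi.
by have : [set` s] i by rewrite -sE; right.
Qed.

Section Lift.
Variable f : forall i, {additive T i -> B}.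

(** Summing over all of [I] avoids choosing a support; [dsum_liftE] allows any duplicate-free list
    containing it. *)
Definition dsum_lift (x : dsum T) : B := \sum_(i \in [set: I]) f i (x i).

Lemma dsum_liftE (x : dsum T) (s : seq I) :
  uniq s -> (forall i, i \notin s -> x i = 0) ->
  dsum_lift x = \sum_(i <- s) f i (x i).
Proof.
move=> us xs; rewrite /dsum_lift (fsbigE s) //; last first.
  by move=> i _ /xs ->; rewrite raddf0.
by apply: eq_bigl => i; rewrite in_setT.
Qed.

Fact dsum_lift_is_additive : zmod_morphism dsum_lift.
Proof.
move=> x y; have [s [us xs ys]] := dsum_supp x y.
have xys i : i \notin s -> (x - y) i = 0.
  by move=> si; rewrite -[LHS]/(x i - y i) xs // ys // subr0.
rewrite !(@dsum_liftE _ s) // -sumrB.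
by apply: eq_bigr => i _; rewrite -raddfB.
Qed.
HB.instance Definition _ := GRing.isZmodMorphism.Build (dsum T) B
  dsum_lift dsum_lift_is_additive.

Lemma dsum_lift_dinj i (x : T i) : dsum_lift (dinj x) = f i x.
Proof.
rewrite (@dsum_liftE _ [:: i]) ?big_seq1 ?dinjE // => j.
by rewrite inE eq_sym => ij; rewrite dinj_neq.
Qed.

End Lift.

Lemma dsum_funD (x y : dsum T) i : (x + y) i = x i + y i.
Proof. by []. Qed.

Lemma dsum_additive_ext (f g : {additive dsum T -> B}) :
  (forall i (x : T i), f (dinj x) = g (dinj x)) -> f =1 g.
Proof.
move=> fg x; have [s [us xs _]] := dsum_supp x x.
suff -> : x = \sum_(i <- s) dinj (x i).
  by rewrite !raddf_sum; apply: eq_bigr => i _.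
apply: dsum_ext => j.
(* Evaluation at the coordinate [j] is additive, so it passes inside the sum. *)
rewrite (@big_morph _ _ (fun y : dsum T => y j) 0 +%R 0 +%R
  (fun y z => dsum_funD y z j) erefl).
have [sj|sj] := boolP (j \in s).
  rewrite (bigD1_seq j) // dinjE big1; first exact/esym/addr0.
  by move=> i ij; rewrite dinj_neq.
rewrite xs // big_seq big1 // => i si; rewrite dinj_neq //.
by apply: contraNneq sj => <-.
Qed.

End DirectSumLift.

(** * Finite products as direct sums *)

Section FiniteProduct.
Variables (n : nat) (T : 'I_n -> zmodType).

Definition zinj (i : 'I_n) (x : T i) : zprod T := dinj_fun x.

Fact zinj_is_additive i : zmod_morphism (@zinj i).
Proof. by move=> x y; exact: (congr1 val (raddfB (@dinj _ T i) x y)). Qed.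
HB.instance Definition _ i :=
  GRing.isZmodMorphism.Build (T i) (zprod T) (@zinj i) (@zinj_is_additive i).

Definition zinj_additive i : {additive T i -> zprod T} := @zinj i.

Lemma zinjE i (x : T i) : zinj x i = x.
Proof. exact: dinjE. Qed.

Lemma zinj_neq i j (x : T i) : i != j -> zinj x j = 0.
Proof. exact: dinj_neq. Qed.

Lemma zprod_funD (x y : zprod T) i : (x + y) i = x i + y i.
Proof. by []. Qed.

Lemma zprod_sum_zinj (x : zprod T) : x = \sum_i zinj (x i).
Proof.
apply: functional_extensionality_dep => j.
rewrite (@big_morph _ _ (fun y : zprod T => y j) 0 +%R 0 +%R
  (fun y z => zprod_funD y z j) erefl).
rewrite (bigD1 j) // zinjE big1; first exact/esym/addr0.
by move=> i ij; rewrite zinj_neq.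
Qed.

End FiniteProduct.

Lemma zprod_map_zinj (n : nat) (T U : 'I_n -> zmodType)
    (f : forall i, {additive T i -> U i}) i (x : T i) :
  zprod_map f (zinj x) = zinj (f i x).
Proof.
apply: functional_extensionality_dep => j; rewrite /zprod_map.
by have [<-|ij] := eqVneq i j; rewrite ?zinjE ?zinj_neq ?raddf0.
Qed.

(** * The Yoneda map of an element of an FI^op-module *)

Section Yoneda.
Variables (X : FIopmod) (S : finType).

Section AtElement.
Variable xi : X S.

Definition yoneda_fun (A : finType) : {additive ZFIop S A -> X A} :=
  zlift (fun h : FIhom A S => FIopmap X h xi).

Fact yoneda_subproof A B (f : FIhom A B) p :
  yoneda_fun A (FIopmap (ZFIop S) f p) = FIopmap X f (yoneda_fun B p).
Proof.
apply: (freeg_additive_ext (f := yoneda_fun A \o ZFI_pre S f)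
  (g := FIopmap X f \o yoneda_fun B)) => h.
by rewrite /= ZFI_pre1 !zlift1 FIopmap_comp.
Qed.

Definition yoneda : FIophom (ZFIop S) X := FIopHom yoneda_subproof.

Lemma yoneda1 A (h : FIhom A S) : yoneda A << h >> = FIopmap X h xi.
Proof. exact: zlift1. Qed.

End AtElement.

Lemma yonedaD xi xi' A p :
  yoneda (xi + xi') A p = yoneda xi A p + yoneda xi' A p.
Proof.
apply: (freeg_additive_ext (f := yoneda (xi + xi') A)
  (g := yoneda xi A \+ yoneda xi' A)) => h.
by rewrite [RHS]/= !yoneda1 raddfD.
Qed.

End Yoneda.

(** By contravariance, both sides send a generator [h] to X_h (X_f xi). *)
Lemma yoneda_post (X : FIopmod) (S T : finType) (f : FIhom S T) xi A p :
  yoneda xi A (ZFI_post A f p) = yoneda (FIopmap X f xi) A p.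
Proof.
apply: (freeg_additive_ext (f := yoneda xi A \o ZFI_post A f)
  (g := yoneda (FIopmap X f xi) A)) => h.
by rewrite /= ZFI_post1 [LHS]yoneda1 [RHS]yoneda1 FIopmap_comp.
Qed.

(** * The map from the tensor product to the cokernel *)

Section TensorCokernel.
Variables (g r : nat) (a : 'I_g -> nat) (b : 'I_r -> nat) (Z : FImatrix a b).
Variables (M : FImod) (phi : FImodhom M (FImod_coker (FIpres Z))).
Hypothesis phi_bij : forall S, bijective (phi S).
Variable X : FIopmod.

Let P S := FImod_sum (fun i => ZFI 'I_(a i)) S.
Let C := coker (FIop_eval Z X).

Definition yoneda_sum S (xi : X S) :
    {additive P S -> zprod (fun i => X 'I_(a i))} :=
  zprod_map (fun i => yoneda xi 'I_(a i)).

Definition pres_class S (p : P S) : FImod_coker (FIpres Z) S := zquot_pi _ p.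

Lemma pres_classP S (x : M S) : exists p, phi S x = pres_class p.
Proof. exact: zquot_pi_surj. Qed.

(** Evaluation at [Z] is natural in the FI^op-module, and [FIpres Z S] is the evaluation at [Z] of Z
    FI(-, S). *)
Fact coker_yoneda_subproof S (xi : X S) q :
  range (FIpres Z S) q ->
  smallest (@zmod_subgroup _) (range (FIop_eval Z X)) (yoneda_sum xi q).
Proof.
case=> y _ <-; apply: sub_gen_smallest.
by rewrite /yoneda_sum [X in _ X](FIop_eval_nat Z (yoneda xi)); eexists.
Qed.

Definition coker_yoneda S (xi : X S) :
    {additive FImod_coker (FIpres Z) S -> C} :=
  zquot_map (@coker_yoneda_subproof S xi).

Lemma coker_yonedaE S (xi : X S) p :
  coker_yoneda xi (pres_class p) = zquot_pi _ (yoneda_sum xi p).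
Proof. exact: zquot_mapE. Qed.

Lemma coker_yonedaD S (xi xi' : X S) q :
  coker_yoneda (xi + xi') q = coker_yoneda xi q + coker_yoneda xi' q.
Proof.
have [p ->] := zquot_pi_surj q; rewrite !coker_yonedaE -raddfD; congr zquot_pi.
by apply: functional_extensionality_dep => i; exact: yonedaD.
Qed.

(** This balancing identity is what kills the relations of [tensorFI]. *)
Lemma coker_yoneda_map S T (f : FIhom S T) (xi : X T) q :
  coker_yoneda xi (FImap (FImod_coker (FIpres Z)) f q) =
  coker_yoneda (FIopmap X f xi) q.
Proof.
have [p ->] := zquot_pi_surj q.
rewrite [in LHS]FImod_coker_mapE !coker_yonedaE; congr zquot_pi.
by apply: functional_extensionality_dep => i; exact: yoneda_post.
Qed.

Definition to_coker_tens S : {additive tensor (M S) (X S) -> C}.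
refine (@tensor_lift (M S) (X S) C (fun x xi => coker_yoneda xi (phi S x)) _ _).
- by move=> x x' y; rewrite !raddfD.
- by move=> x y y'; exact: coker_yonedaD.
Defined.

Fact to_coker_subproof w : @tensorFI_rel M X w ->
  dsum_lift (fun n => to_coker_tens 'I_n) w = 0.
Proof.
move=> [m [n [f [x [xi ->]]]]].
rewrite raddfB /tensorFI_in /= !dsum_lift_dinj !tensor_liftE.
by rewrite FImodhomP coker_yoneda_map subrr.
Qed.

Definition to_coker : {additive tensorFI M X -> C} :=
  zquot_lift to_coker_subproof.

Definition tensFI n (x : M 'I_n) (xi : X 'I_n) : tensorFI M X :=
  zquot_pi _ (tensorFI_in x xi).

Lemma to_cokerE n (x : M 'I_n) (xi : X 'I_n) p :
  phi _ x = pres_class p ->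
  to_coker (tensFI x xi) = zquot_pi _ (yoneda_sum xi p).
Proof.
move=> xp; rewrite [LHS]zquot_liftE /= [LHS]dsum_lift_dinj.
by rewrite [LHS]tensor_liftE xp coker_yonedaE.
Qed.

(** The elementary tensor with one factor fixed, written here and in [tensFI_right] as a composite
    of additive maps so that sums and [zlift] can be moved through it. *)
Definition tensFI_left n (x : M 'I_n) : {additive X 'I_n -> tensorFI M X} :=
  zquot_pi (@tensorFI_rel M X)
  \o @dinj_additive _ (fun n : nat => tensor (M 'I_n) (X 'I_n)) n
  \o @tens (M 'I_n) (X 'I_n) x.

Definition tensFI_right n (xi : X 'I_n) : {additive M 'I_n -> tensorFI M X} :=
  zquot_pi (@tensorFI_rel M X)
  \o @dinj_additive _ (fun n : nat => tensor (M 'I_n) (X 'I_n)) n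
  \o @tens_right (M 'I_n) (X 'I_n) xi.

Lemma tensFI_map m n (f : FIhom 'I_m 'I_n) (x : M 'I_m) (xi : X 'I_n) :
  tensFI (FImap M f x) xi = tensFI x (FIopmap X f xi).
Proof.
apply/eqP; rewrite -subr_eq0 -raddfB; apply/eqP/zquot_pi_eq0.
by exists m, n, f, x, xi.
Qed.

Lemma tensorFI_additive_ext (B : zmodType)
    (u v : {additive tensorFI M X -> B}) :
  (forall n (x : M 'I_n) (xi : X 'I_n), u (tensFI x xi) = v (tensFI x xi)) ->
  u =1 v.
Proof.
move=> uv w; have [y ->] := zquot_pi_surj w.
apply: (dsum_additive_ext (f := u \o zquot_pi _) (g := v \o zquot_pi _)).
move=> n t; apply: (tensor_additive_ext
  (f := u \o zquot_pi _ \o @dinj_additive _ _ n)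
  (g := v \o zquot_pi _ \o @dinj_additive _ _ n)) => x xi.
exact: uv.
Qed.

(** * Generators of the presentation and the inverse map *)

Definition pres_gen i : P 'I_(a i) := zinj (<< FIid 'I_(a i) >>).

Variable m : forall i, M 'I_(a i).
Hypothesis mP : forall i, phi _ (m i) = pres_class (pres_gen i).

(** A basis element [h] in the summand [i] is the image under [h] of the identity of [a_i], that is,
    of [pres_gen i]. *)
Lemma pres_genE S (p : P S) : p = \sum_i
  zlift (fun h : FIhom 'I_(a i) S => FImap (FImod_sum _) h (pres_gen i)) (p i).
Proof.
rewrite {1}(zprod_sum_zinj p); apply: eq_bigr => i _.
apply: (freeg_additive_ext
  (f := @zinj_additive _ (fun i => ZFI 'I_(a i) S) i)) => h.
rewrite [RHS]zlift1 [RHS]zprod_map_zinj; congr zinj.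
by rewrite [RHS]ZFI_post1 FIcomp1r.
Qed.

(** The expansion [pres_genE] passes to the cokernel, and the natural injection [phi] reflects it
    back to [M]. *)
Lemma phi_gen S (x : M S) p : phi S x = pres_class p ->
  x = \sum_i zlift (fun h : FIhom 'I_(a i) S => FImap M h (m i)) (p i).
Proof.
move=> xp; apply: (bij_inj (phi_bij S)); rewrite xp {1}(pres_genE p) !raddf_sum.
rewrite /pres_class raddf_sum; apply: eq_bigr => i _; rewrite !raddf_zlift.
congr zlift; apply: functional_extensionality_dep => h.
by rewrite FImodhomP mP [RHS]FImod_coker_mapE.
Qed.

Definition of_zprod (y : zprod (fun i => X 'I_(a i))) : tensorFI M X :=
  \sum_i tensFI_left (m i) (y i).

Fact of_zprod_is_additive : zmod_morphism of_zprod.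
Proof.
move=> y y'; rewrite /of_zprod -sumrB.
by apply: eq_bigr => i _; rewrite -raddfB.
Qed.
HB.instance Definition _ := GRing.isZmodMorphism.Build
  (zprod (fun i => X 'I_(a i))) (tensorFI M X) of_zprod of_zprod_is_additive.

(* Both sides are additive in [p], and agree on [p = h o pres_gen i] because
   [h m_i (x) xi] is identified with [m_i (x) X_h xi]. *)
Lemma of_zprod_yoneda n (x : M 'I_n) (xi : X 'I_n) p :
  phi _ x = pres_class p -> of_zprod (yoneda_sum xi p) = tensFI x xi.
Proof.
move=> /phi_gen ->; rewrite -[RHS]/(tensFI_right xi _) raddf_sum.
apply: eq_bigr => i _.
rewrite -[yoneda_sum xi p i]/(zlift (fun h => FIopmap X h xi) (p i)).
rewrite !raddf_zlift; congr zlift.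
by apply: functional_extensionality_dep => h; rewrite [RHS]tensFI_map.
Qed.

(* An element of the range is a sum of [yoneda_sum xi q] with [q] in the range
   of [FIpres Z S], hence is sent to a sum of tensors [0 (x) xi]. *)
Fact of_coker_subproof y : range (FIop_eval Z X) y -> of_zprod y = 0.
Proof.
case=> x _ <-.
(* By Yoneda, [x j] is the value of [yoneda (x j)] at the identity of [b_j]. *)
have -> : x = \sum_j zprod_map (fun k => yoneda (x j) 'I_(b k))
    (zinj (<< FIid 'I_(b j) >>)).
  rewrite {1}(zprod_sum_zinj x); apply: eq_bigr => j _.
  by rewrite zprod_map_zinj yoneda1 FIopmap_id.
rewrite !raddf_sum big1 // => j _; rewrite -FIop_eval_nat.
rewrite [LHS](of_zprod_yoneda (x := 0)); first exact: (raddf0 (tensFI_right _)).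
rewrite raddf0; apply/esym/zquot_pi_eq0.
by eexists.
Qed.

Definition of_coker : {additive C -> tensorFI M X} :=
  zquot_lift of_coker_subproof.

Lemma of_cokerE y : of_coker (zquot_pi _ y) = of_zprod y.
Proof. exact: zquot_liftE. Qed.

Lemma to_cokerK : cancel to_coker of_coker.
Proof.
apply: (tensorFI_additive_ext (u := of_coker \o to_coker) (v := idfun)).
move=> n x xi; have [p xp] := pres_classP x.
rewrite -[LHS]/(of_coker (to_coker (tensFI x xi))).
by rewrite (to_cokerE _ xp) of_cokerE (of_zprod_yoneda _ xp).
Qed.

Lemma of_cokerK : cancel of_coker to_coker.
Proof.
move=> q; have [y ->] := zquot_pi_surj q; rewrite of_cokerE.
rewrite /of_zprod [in RHS](zprod_sum_zinj y) !raddf_sum.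
(* The class of [m i] is represented by the identity in coordinate [i], which [yoneda (y i)] sends
   back to [y i]. *)
apply: eq_bigr => i _; rewrite [LHS](to_cokerE _ (mP i)); congr zquot_pi.
by rewrite [LHS]zprod_map_zinj yoneda1 FIopmap_id.
Qed.

End TensorCokernel.

(** * The isomorphism for every FI^op-module, then for Xi(l) *)

Lemma tensorFI_coker (g r : nat) (a : 'I_g -> nat) (b : 'I_r -> nat)
    (Z : FImatrix a b) (M : FImod) (X : FIopmod) :
  presentation_matrix Z M -> zmod_iso (tensorFI M X) (coker (FIop_eval Z X)).
Proof.
move=> [phi phi_bij].
have genP i : exists x : M 'I_(a i), phi _ x = pres_class Z (pres_gen a i).
  have [psi _ psiK] := phi_bij 'I_(a i).
  by exists (psi (pres_class Z (pres_gen a i))); rewrite psiK.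
(* One preimage of each generator is fixed by choice. *)
pose m i := projT1 (cid (genP i)).
have mP i : phi _ (m i) = pres_class Z (pres_gen a i).
  exact: projT2 (cid (genP i)).
exists (to_coker phi X); exists (of_coker phi_bij X mP).
  exact: to_cokerK.
exact: of_cokerK.
Qed.

Theorem theoremD (R : realType) (g r : nat) (a : 'I_g -> nat) (b : 'I_r -> nat)
    (Z : FImatrix a b) (M : FImod) (hZ : presentation_matrix Z M) (l : nat) :
  zmod_iso (FJtail R M l) (coker (FIop_eval Z (Xi R l))).
Proof. exact: tensorFI_coker. Qed.
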